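(* Let $W=W_{D_n}$ ($n\ge4$) or $W=W_{B_n}$ ($n\ge2$), and let $\mathfrak{H}^-_W$ be the degenerate spin affine Hecke algebra of type $D_n$ (parameter $u\in\mathbb{C}$), respectively of type $B_n$ (parameters $u,v\in\mathbb{C}$). The multiplication of the subalgebras $\mathbb{C}W^-$ and $\mathcal{C}[b_1,\dots,b_n]$ induces a vector space isomorphism $$\mathcal{C}[b_1,\dots,b_n]\otimes\mathbb{C}W^-\xrightarrow{\ \simeq\ }\mathfrak{H}^-_W.$$
   Context: All algebras are unital associative over $\mathbb{C}$. $\mathcal{C}[b_1,\dots,b_n]$ is the skew-polynomial algebra generated by $b_1,\dots,b_n$ with relations $b_ib_j+b_jb_i=0$ ($i\neq j$). The spin Weyl group algebra $\mathbb{C}W^-$ is generated by $t_1,\dots,t_n$ with relations: $t_i^2=1$; $t_it_{i+1}t_i=t_{i+1}t_it_{i+1}$ ($1\le i\le n-2$); $(t_it_j)^2=-1$ ($|i-j|>1$, $i,j\le n-1$); in type $D_n$: $(t_it_n)^2=-1$ ($i\neq n-2,n$), $t_{n-2}t_nt_{n-2}=t_nt_{n-2}t_n$; in type $B_n$: $(t_it_n)^2=-1$ ($i\le n-2$), $(t_{n-1}t_n)^4=-1$. (It has dimension $|W|$.) $\mathfrak{H}^-_W$ is the algebra generated by $\mathcal{C}[b_1,\dots,b_n]$ and $\mathbb{C}W^-$ subject to: for $1\le i\le n-1$, $t_ib_i+b_{i+1}t_i=u$ and $t_ib_j=-b_jt_i$ ($j\neq i,i+1$); in type $D_n$: $t_nb_n+b_{n-1}t_n=u$,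 $t_nb_i=-b_it_n$ ($i\ne n-1,n$); in type $B_n$: $t_nb_n+b_nt_n=v$, $t_nb_i=-b_it_n$ ($i\neq n$). *)

(* Defs.v *)
From HB Require Import structures.
From mathcomp Require Import all_boot all_order all_algebra.
From mathcomp Require Import generic_quotient.
From mathcomp Require Import finmap monalg.
From mathcomp Require Import boolp.

Set Implicit Arguments.
Unset Strict Implicit.
Unset Printing Implicit Defensive.

Import GRing.Theory.
Local Open Scope ring_scope.
Local Open Scope quotient_scope.

(* The free unital associative K-algebra on X: the monoid algebra of the free
   monoid on X. *)
Notation freeAlg K X := {malg K[{fmonom X}]}.

Definition fgen (K : comNzRingType) (X : choiceType) (x : X) : freeAlg K X :=
  << fmu x >>.

Lemma freeAlg_scaleAr (K : comNzRingType) (X : choiceType) (c : K)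
  (a b : freeAlg K X) : c *: (a * b) = a * (c *: b).
Proof.
apply/malgP => k; transitivity (c * (a * b)@_k); first exact: mcoeffZ.
rewrite [X in c * X]mcoeffMl mulr_sumr.
rewrite [RHS](mcoeffMlw _ (fsubset_refl _) (msuppZ_le c b)).
apply: eq_bigr => k1 _; rewrite mulr_sumr; apply: eq_bigr => k2 _.
by rewrite mcoeffZ mulrnAr mulrCA.
Qed.

(* presAlg r is the quotient of the free algebra on X by the two-sided ideal
   relIdeal r generated by the a - b with r a b. It may be the zero ring, which
   MathComp's lalgType excludes, so its algebra structure is given as a
   pzRingType, an lmodType K and the lemmas presAlg_scaleAl, presAlg_scaleAr. *)
Section PresentedAlgebra.
Variables (K : comNzRingType) (X : choiceType).
Local Notation F := (freeAlg K X).
Variable r : F -> F -> Prop.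

Inductive relIdeal : F -> Prop :=
| relIdeal_rel a b : r a b -> relIdeal (a - b)
| relIdeal0 : relIdeal 0
| relIdealD a b : relIdeal a -> relIdeal b -> relIdeal (a + b)
| relIdealMl c a : relIdeal a -> relIdeal (c * a)
| relIdealMr c a : relIdeal a -> relIdeal (a * c).

Definition relIdealb : pred F := fun a => `[< relIdeal a >].

Lemma relIdeal_zmod_closed : zmod_closed relIdealb.
Proof.
split; first by apply/asboolP; exact: relIdeal0.
move=> a b /asboolP Ia /asboolP Ib; apply/asboolP; apply: relIdealD => //.
by rewrite -mulN1r; exact: relIdealMl.
Qed.

HB.instance Definition _ := GRing.isZmodClosed.Build F relIdealb
  relIdeal_zmod_closed.

Definition presAlg := Quotient.quot (GRing.ZmodClosed.clone F relIdealb _).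

HB.instance Definition _ := Choice.on presAlg.
HB.instance Definition _ := GRing.Zmodule.on presAlg.
HB.instance Definition _ := EqQuotient.on presAlg.

Definition ppi (a : F) : presAlg := \pi_presAlg a.

Lemma ppi_eq a b : ppi a = ppi b <-> relIdeal (a - b).
Proof.
rewrite /ppi; split=> [/eqP|Iab].
  by rewrite -Quotient.idealrBE => /asboolP.
by apply/eqP; rewrite -Quotient.idealrBE; apply/asboolP.
Qed.

Lemma ppi_repr p : ppi (repr p) = p.
Proof. exact: reprK. Qed.

Lemma ppi_repr_ideal a : relIdeal (repr (ppi a) - a).
Proof. by apply/ppi_eq; rewrite ppi_repr. Qed.

Lemma ppi0 : ppi 0 = 0.
Proof. by rewrite /ppi piE. Qed.

Lemma ppiD a b : ppi (a + b) = ppi a + ppi b.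
Proof. by rewrite /ppi piE. Qed.

Definition pone : presAlg := ppi 1.
Definition pmul : presAlg -> presAlg -> presAlg := lift_op2 presAlg *%R.
Definition pscale (c : K) : presAlg -> presAlg := lift_op1 presAlg ( *:%R c).

Lemma ppi_mul a b : pmul (ppi a) (ppi b) = ppi (a * b).
Proof.
rewrite /pmul; unlock; apply/ppi_eq; set a' := repr _; set b' := repr _.
rewrite (_ : a' * b' - a * b = (a' - a) * b' + a * (b' - b)).
  by apply: relIdealD; [apply: relIdealMr | apply: relIdealMl];
    exact: ppi_repr_ideal.
by rewrite mulrBl mulrBr addrA subrK.
Qed.

Lemma ppi_scale c a : pscale c (ppi a) = ppi (c *: a).
Proof.
rewrite /pscale; unlock; apply/ppi_eq; rewrite -scalerBr -[_ - a]mul1r scalerAl.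
by apply: relIdealMl; exact: ppi_repr_ideal.
Qed.

Fact pmulA : associative pmul.
Proof.
move=> p q s; rewrite -[p]ppi_repr -[q]ppi_repr -[s]ppi_repr.
by rewrite !ppi_mul mulrA.
Qed.

Fact pmul1 : left_id pone pmul.
Proof. by move=> p; rewrite -[p]ppi_repr ppi_mul mul1r. Qed.

Fact pmulr1 : right_id pone pmul.
Proof. by move=> p; rewrite -[p]ppi_repr ppi_mul mulr1. Qed.

Fact pmulDl : left_distributive pmul +%R.
Proof.
move=> p q s; rewrite -[p]ppi_repr -[q]ppi_repr -[s]ppi_repr.
by rewrite !(ppi_mul, =^~ ppiD) mulrDl.
Qed.

Fact pmulDr : right_distributive pmul +%R.
Proof.
move=> p q s; rewrite -[p]ppi_repr -[q]ppi_repr -[s]ppi_repr.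
by rewrite !(ppi_mul, =^~ ppiD) mulrDr.
Qed.

HB.instance Definition _ := GRing.Zmodule_isPzRing.Build presAlg
  pmulA pmul1 pmulr1 pmulDl pmulDr.

Fact pscaleA a b p : pscale a (pscale b p) = pscale (a * b) p.
Proof. by rewrite -[p]ppi_repr !ppi_scale scalerA. Qed.

Fact pscale1 : left_id 1 pscale.
Proof. by move=> p; rewrite -[p]ppi_repr ppi_scale scale1r. Qed.

Fact pscaleDr : right_distributive pscale +%R.
Proof.
move=> c p q; rewrite -[p]ppi_repr -[q]ppi_repr.
by rewrite !(ppi_scale, =^~ ppiD) scalerDr.
Qed.

Fact pscaleDl p : {morph pscale^~ p : a b / a + b}.
Proof.
by move=> a b; rewrite -[p]ppi_repr !(ppi_scale, =^~ ppiD) scalerDl.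
Qed.

HB.instance Definition _ := GRing.Zmodule_isLmodule.Build K presAlg
  pscaleA pscale1 pscaleDr pscaleDl.

Lemma ppi1 : ppi 1 = 1. Proof. by []. Qed.

Lemma ppiM a b : ppi (a * b) = ppi a * ppi b.
Proof. by rewrite -ppi_mul. Qed.

Lemma ppiZ c a : ppi (c *: a) = c *: ppi a.
Proof. by rewrite -ppi_scale. Qed.

Lemma presAlg_scaleAl (c : K) (p q : presAlg) : c *: (p * q) = (c *: p) * q.
Proof. by rewrite -[p]ppi_repr -[q]ppi_repr -ppiM -!ppiZ -ppiM scalerAl. Qed.

Lemma presAlg_scaleAr (c : K) (p q : presAlg) : c *: (p * q) = p * (c *: q).
Proof.
by rewrite -[p]ppi_repr -[q]ppi_repr -ppiM -!ppiZ -ppiM freeAlg_scaleAr.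
Qed.

Definition pgen (x : X) : presAlg := ppi (fgen K x).

Lemma presAlg_rel a b : r a b -> ppi a = ppi b.
Proof. by move=> rab; apply/ppi_eq/relIdeal_rel. Qed.

End PresentedAlgebra.

Section Functoriality.
Variables (K : comNzRingType) (X Y : choiceType).

Definition wordMap (f : X -> Y) (m : {fmonom X}) : freeAlg K Y :=
  \prod_(x <- fmonom_val m) fgen K (f x).

Fact wordMap_mmorphism f : mmorphism (wordMap f).
Proof.
split=> [m1 m2|]; rewrite /wordMap; first by rewrite fmM big_cat.
by rewrite fm1 big_nil.
Qed.

HB.instance Definition _ f :=
  isMultiplicative.Build {fmonom X} (freeAlg K Y) (wordMap f)
    (wordMap_mmorphism f).

Definition freeMap (f : X -> Y) : freeAlg K X -> freeAlg K Y :=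
  mmap (@malgC {fmonom Y} K) (wordMap f).

HB.instance Definition _ f := GRing.Additive.on (freeMap f).

Fact freeMap_monoid_morphism f : monoid_morphism (freeMap f).
Proof.
have [|fM f1] := @commr_mmap_is_multiplicative {fmonom X} K (freeAlg K Y)
  (@malgC {fmonom Y} K) (wordMap f); last by split.
have comm_c c (q : freeAlg K Y) : c%:MP * q = q * c%:MP.
  rewrite -[in RHS](mulr1 c%:MP) [in RHS]mul_malgC -freeAlg_scaleAr mulr1.
  by rewrite mul_malgC.
by move=> g m m'; exact: comm_c.
Qed.

HB.instance Definition _ f :=
  GRing.isMonoidMorphism.Build _ _ (freeMap f) (freeMap_monoid_morphism f).

Fact freeMapZ f c a : freeMap f (c *: a) = c *: freeMap f a.
Proof. by rewrite /freeMap mmapZ mul_malgC. Qed.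

HB.instance Definition _ f :=
  GRing.isScalable.Build K _ _ *:%R (freeMap f) (freeMapZ f).

Lemma freeMap_gen f x : freeMap f (fgen K x) = fgen K (f x).
Proof. by rewrite /freeMap mmapU /= mpolyC1E mul1r /wordMap fmU big_seq1. Qed.

Variables (r : freeAlg K X -> freeAlg K X -> Prop).
Variables (s : freeAlg K Y -> freeAlg K Y -> Prop).

(* The algebra morphism extending f on generators; this is meaningful when f
   carries the relations r to the relations s, see section Morphism. *)
Definition presMap (f : X -> Y) (p : presAlg r) : presAlg s :=
  ppi s (freeMap f (repr p)).

Section Morphism.
Variable f : X -> Y.
Hypothesis f_rel : forall a b, r a b -> s (freeMap f a) (freeMap f b).

Lemma presMap_pi a : presMap f (ppi r a) = ppi s (freeMap f a).
Proof.
apply/ppi_eq; rewrite -rmorphB; elim: (ppi_repr_ideal r a) => {a}.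
- by move=> a b /f_rel sab; rewrite rmorphB; exact: relIdeal_rel.
- by rewrite rmorph0; exact: relIdeal0.
- by move=> a b _ Ia _ Ib; rewrite rmorphD; exact: relIdealD.
- by move=> c a _ Ia; rewrite rmorphM; exact: relIdealMl.
- by move=> c a _ Ia; rewrite rmorphM; exact: relIdealMr.
Qed.

Lemma presMap_gen x : presMap f (pgen r x) = pgen s (f x).
Proof. by rewrite presMap_pi freeMap_gen. Qed.

Lemma presMap1 : presMap f 1 = 1.
Proof. by rewrite -ppi1 presMap_pi rmorph1. Qed.

Lemma presMapM : {morph presMap f : p q / p * q}.
Proof.
move=> p q; rewrite -[p]ppi_repr -[q]ppi_repr -ppiM !presMap_pi.
by rewrite rmorphM ppiM.
Qed.

Lemma presMap_linear : linear (presMap f).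
Proof.
move=> c p q; rewrite -[p]ppi_repr -[q]ppi_repr -ppiZ -ppiD !presMap_pi.
by rewrite linearP ppiD ppiZ.
Qed.

End Morphism.
End Functoriality.
Arguments presMap {K X Y} r s f p.

(* The free K-module on A * B modulo the bilinearity relations. *)
Section TensorProduct.
Variables (K : comNzRingType) (A B : lmodType K).
Local Notation F := {malg K[(A * B)%type]}.

Inductive tensorNull : F -> Prop :=
| tensorNull_Dl a a' b :
    tensorNull (<< (a + a', b) >> - (<< (a, b) >> + << (a', b) >>))
| tensorNull_Dr a b b' :
    tensorNull (<< (a, b + b') >> - (<< (a, b) >> + << (a, b') >>))
| tensorNull_Zl c a b : tensorNull (<< (c *: a, b) >> - c *: << (a, b) >>)
| tensorNull_Zr c a b : tensorNull (<< (a, c *: b) >> - c *: << (a, b) >>)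
| tensorNull0 : tensorNull 0
| tensorNullD x y : tensorNull x -> tensorNull y -> tensorNull (x + y)
| tensorNullZ c x : tensorNull x -> tensorNull (c *: x).

Definition tensorNullb : pred F := fun x => `[< tensorNull x >].

Fact tensorNull_zmod_closed : zmod_closed tensorNullb.
Proof.
split; first by apply/asboolP; exact: tensorNull0.
move=> x y /asboolP Nx /asboolP Ny; apply/asboolP; apply: tensorNullD => //.
by rewrite -scaleN1r; exact: tensorNullZ.
Qed.

HB.instance Definition _ := GRing.isZmodClosed.Build F tensorNullb
  tensorNull_zmod_closed.

Definition tensor := Quotient.quot (GRing.ZmodClosed.clone F tensorNullb _).

HB.instance Definition _ := Choice.on tensor.
HB.instance Definition _ := GRing.Zmodule.on tensor.
HB.instance Definition _ := EqQuotient.on tensor.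

Definition tpi (x : F) : tensor := \pi_tensor x.

Lemma tpi_eq x y : tpi x = tpi y <-> tensorNull (x - y).
Proof.
rewrite /tpi; split=> [/eqP|Nxy].
  by rewrite -Quotient.idealrBE => /asboolP.
by apply/eqP; rewrite -Quotient.idealrBE; apply/asboolP.
Qed.

Lemma tpi_repr p : tpi (repr p) = p.
Proof. exact: reprK. Qed.

Lemma tpiD x y : tpi (x + y) = tpi x + tpi y.
Proof. by rewrite /tpi piE. Qed.

Definition tscale (c : K) : tensor -> tensor := lift_op1 tensor ( *:%R c).

Lemma tpi_scale c x : tscale c (tpi x) = tpi (c *: x).
Proof.
rewrite /tscale; unlock; apply/tpi_eq; rewrite -scalerBr.
apply: tensorNullZ.
by apply/tpi_eq; rewrite tpi_repr.
Qed.

Fact tscaleA a b p : tscale a (tscale b p) = tscale (a * b) p.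
Proof. by rewrite -[p]tpi_repr !tpi_scale scalerA. Qed.

Fact tscale1 : left_id 1 tscale.
Proof. by move=> p; rewrite -[p]tpi_repr tpi_scale scale1r. Qed.

Fact tscaleDr : right_distributive tscale +%R.
Proof.
move=> c p q; rewrite -[p]tpi_repr -[q]tpi_repr -tpiD !tpi_scale.
by rewrite scalerDr tpiD.
Qed.

Fact tscaleDl p : {morph tscale^~ p : a b / a + b}.
Proof. by move=> a b; rewrite -[p]tpi_repr !tpi_scale scalerDl tpiD. Qed.

HB.instance Definition _ := GRing.Zmodule_isLmodule.Build K tensor
  tscaleA tscale1 tscaleDr tscaleDl.

Lemma tpiZ c x : tpi (c *: x) = c *: tpi x.
Proof. by rewrite -tpi_scale. Qed.

Definition tens (a : A) (b : B) : tensor := tpi << (a, b) >>.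

Lemma tensDl a a' b : tens (a + a') b = tens a b + tens a' b.
Proof. by rewrite -tpiD; apply/tpi_eq/tensorNull_Dl. Qed.

Lemma tensDr a b b' : tens a (b + b') = tens a b + tens a b'.
Proof. by rewrite -tpiD; apply/tpi_eq/tensorNull_Dr. Qed.

Lemma tensZl c a b : tens (c *: a) b = c *: tens a b.
Proof. by rewrite -tpiZ; apply/tpi_eq/tensorNull_Zl. Qed.

Lemma tensZr c a b : tens a (c *: b) = c *: tens a b.
Proof. by rewrite -tpiZ; apply/tpi_eq/tensorNull_Zr. Qed.

End TensorProduct.

Arguments tensor {K} A B.

(* Generators are indexed by 'I_n, which starts at 0; the side conditions of the
   relations are stated on the 1-based index idx i. *)
Definition idx n (i : 'I_n) : nat := i.+1.

Section Relations.
Variables (K : comNzRingType) (X : choiceType) (n : nat).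
Local Notation F := (freeAlg K X).
Variables (b t : 'I_n -> F) (u v : K).
Implicit Types i j p l : 'I_n.

Inductive skew_rel : F -> F -> Prop :=
| skew_anticomm i j : i != j -> skew_rel (b i * b j + b j * b i) 0.

Inductive spin_rel : F -> F -> Prop :=
| spin_sq i : spin_rel (t i ^+ 2) 1
| spin_braid i j : (idx i <= n - 2)%N -> idx j = (idx i).+1 ->
    spin_rel (t i * t j * t i) (t j * t i * t j)
| spin_far i j : (idx i <= n - 1)%N -> (idx j <= n - 1)%N ->
    ((idx i).+1 < idx j)%N || ((idx j).+1 < idx i)%N ->
    spin_rel ((t i * t j) ^+ 2) (- 1).

Inductive spinD_rel : F -> F -> Prop :=
| spinD_common x y : spin_rel x y -> spinD_rel x y
| spinD_far i l : idx l = n -> idx i <> (n - 2)%N -> idx i <> n ->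
    spinD_rel ((t i * t l) ^+ 2) (- 1)
| spinD_braid p l : idx l = n -> idx p = (n - 2)%N ->
    spinD_rel (t p * t l * t p) (t l * t p * t l).

Inductive spinB_rel : F -> F -> Prop :=
| spinB_common x y : spin_rel x y -> spinB_rel x y
| spinB_far i l : idx l = n -> (idx i <= n - 2)%N ->
    spinB_rel ((t i * t l) ^+ 2) (- 1)
| spinB_last p l : idx l = n -> idx p = (n - 1)%N ->
    spinB_rel ((t p * t l) ^+ 4) (- 1).

Inductive cross_rel : F -> F -> Prop :=
| cross_adj i j : (idx i <= n - 1)%N -> idx j = (idx i).+1 ->
    cross_rel (t i * b i + b j * t i) (u *: 1)
| cross_far i j : (idx i <= n - 1)%N -> idx j <> idx i ->
    idx j <> (idx i).+1 -> cross_rel (t i * b j) (- (b j * t i)).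

Inductive crossD_rel : F -> F -> Prop :=
| crossD_common x y : cross_rel x y -> crossD_rel x y
| crossD_last p l : idx l = n -> idx p = (n - 1)%N ->
    crossD_rel (t l * b l + b p * t l) (u *: 1)
| crossD_far i l : idx l = n -> idx i <> (n - 1)%N -> idx i <> n ->
    crossD_rel (t l * b i) (- (b i * t l)).

Inductive crossB_rel : F -> F -> Prop :=
| crossB_common x y : cross_rel x y -> crossB_rel x y
| crossB_last l : idx l = n -> crossB_rel (t l * b l + b l * t l) (v *: 1)
| crossB_far i l : idx l = n -> idx i <> n ->
    crossB_rel (t l * b i) (- (b i * t l)).

End Relations.

Section Algebras.
Variables (K : comNzRingType) (n : nat) (u v : K).
(* inl i is the generator b_i, inr i is the generator t_i. *)
Local Notation X := ('I_n + 'I_n)%type.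
Let bH (i : 'I_n) : freeAlg K X := fgen K (inl i).
Let tH (i : 'I_n) : freeAlg K X := fgen K (inr i).

Definition heckeD_rel (x y : freeAlg K X) : Prop :=
  [\/ skew_rel bH x y, spinD_rel tH x y | crossD_rel bH tH u x y].

Definition heckeB_rel (x y : freeAlg K X) : Prop :=
  [\/ skew_rel bH x y, spinB_rel tH x y | crossB_rel bH tH u v x y].

Definition skewPoly := presAlg (skew_rel (@fgen K 'I_n)).
Definition spinWeylD := presAlg (spinD_rel (@fgen K 'I_n)).
Definition spinWeylB := presAlg (spinB_rel (@fgen K 'I_n)).
Definition spinHeckeD := presAlg heckeD_rel.
Definition spinHeckeB := presAlg heckeB_rel.

HB.instance Definition _ := GRing.PzRing.on skewPoly.
HB.instance Definition _ := GRing.Lmodule.on skewPoly.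
HB.instance Definition _ := GRing.PzRing.on spinWeylD.
HB.instance Definition _ := GRing.Lmodule.on spinWeylD.
HB.instance Definition _ := GRing.PzRing.on spinWeylB.
HB.instance Definition _ := GRing.Lmodule.on spinWeylB.
HB.instance Definition _ := GRing.PzRing.on spinHeckeD.
HB.instance Definition _ := GRing.Lmodule.on spinHeckeD.
HB.instance Definition _ := GRing.PzRing.on spinHeckeB.
HB.instance Definition _ := GRing.Lmodule.on spinHeckeB.

Definition skew_inD : skewPoly -> spinHeckeD := presMap _ _ inl.
Definition weyl_inD : spinWeylD -> spinHeckeD := presMap _ _ inr.
Definition skew_inB : skewPoly -> spinHeckeB := presMap _ _ inl.
Definition weyl_inB : spinWeylB -> spinHeckeB := presMap _ _ inr.

End Algebras.

Arguments heckeD_rel {K} n u x y.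
Arguments heckeB_rel {K} n u v x y.
Arguments spinHeckeD {K} n u.
Arguments spinHeckeB {K} n u v.
Arguments skew_inD {K} n u p.
Arguments weyl_inD {K} n u p.
Arguments skew_inB {K} n u v p.
Arguments weyl_inB {K} n u v p.

Section Embeddings.
Variables (K : comNzRingType) (n : nat) (u v : K).

Section RelMap.
Variables (X Y : choiceType) (f : X -> Y).
Variables (g : 'I_n -> freeAlg K X) (g' : 'I_n -> freeAlg K Y).
Hypothesis fg : forall i, freeMap f (g i) = g' i.

Let fgM i j : freeMap f (g i * g j) = g' i * g' j.
Proof. by rewrite rmorphM /= !fg. Qed.

Let fgMM i j k : freeMap f (g i * g j * g k) = g' i * g' j * g' k.
Proof. by rewrite rmorphM /= fgM fg. Qed.

Let fgMX i j m : freeMap f ((g i * g j) ^+ m) = (g' i * g' j) ^+ m.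
Proof. by rewrite rmorphXn /= fgM. Qed.

Lemma skew_rel_map x y :
  skew_rel g x y -> skew_rel g' (freeMap f x) (freeMap f y).
Proof.
case=> i j ij; rewrite (rmorph0 (freeMap f)) [X in skew_rel _ X _]rmorphD.
rewrite [X in skew_rel _ (X + _) _]fgM [X in skew_rel _ (_ + X) _]fgM.
exact: skew_anticomm.
Qed.

Lemma spin_rel_map x y :
  spin_rel g x y -> spin_rel g' (freeMap f x) (freeMap f y).
Proof.
case=> [i|i j ? ?|i j ? ? ?].
- by rewrite rmorphXn rmorph1 /= fg; exact: spin_sq.
- rewrite [X in spin_rel _ X _]fgMM [X in spin_rel _ _ X]fgMM.
  exact: spin_braid.
- by rewrite fgMX rmorphN1; exact: spin_far.
Qed.

Lemma spinD_rel_map x y :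
  spinD_rel g x y -> spinD_rel g' (freeMap f x) (freeMap f y).
Proof.
case=> [{}x {}y /spin_rel_map|i l ? ? ?|p l ? ?].
- exact: spinD_common.
- by rewrite fgMX rmorphN1; exact: spinD_far.
- rewrite [X in spinD_rel _ X _]fgMM [X in spinD_rel _ _ X]fgMM.
  exact: spinD_braid.
Qed.

Lemma spinB_rel_map x y :
  spinB_rel g x y -> spinB_rel g' (freeMap f x) (freeMap f y).
Proof.
case=> [{}x {}y /spin_rel_map|i l ? ?|p l ? ?].
- exact: spinB_common.
- by rewrite fgMX rmorphN1; exact: spinB_far.
- by rewrite fgMX rmorphN1; exact: spinB_last.
Qed.

End RelMap.

Fact skew_inD_rel x y : skew_rel (@fgen K 'I_n) x y ->
  heckeD_rel n u (freeMap inl x) (freeMap inl y).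
Proof.
by move=> rxy; apply: Or31; apply: skew_rel_map rxy => i; exact: freeMap_gen.
Qed.

Fact weyl_inD_rel x y : spinD_rel (@fgen K 'I_n) x y ->
  heckeD_rel n u (freeMap inr x) (freeMap inr y).
Proof.
by move=> rxy; apply: Or32; apply: spinD_rel_map rxy => i; exact: freeMap_gen.
Qed.

Fact skew_inB_rel x y : skew_rel (@fgen K 'I_n) x y ->
  heckeB_rel n u v (freeMap inl x) (freeMap inl y).
Proof.
by move=> rxy; apply: Or31; apply: skew_rel_map rxy => i; exact: freeMap_gen.
Qed.

Fact weyl_inB_rel x y : spinB_rel (@fgen K 'I_n) x y ->
  heckeB_rel n u v (freeMap inr x) (freeMap inr y).
Proof.
by move=> rxy; apply: Or32; apply: spinB_rel_map rxy => i; exact: freeMap_gen.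
Qed.

HB.instance Definition _ := GRing.isLinear.Build K _ _ *:%R
  (skew_inD n u) (presMap_linear skew_inD_rel).
HB.instance Definition _ := GRing.isMonoidMorphism.Build _ _
  (skew_inD n u) (presMap1 skew_inD_rel, presMapM skew_inD_rel).
HB.instance Definition _ := GRing.isLinear.Build K _ _ *:%R
  (weyl_inD n u) (presMap_linear weyl_inD_rel).
HB.instance Definition _ := GRing.isMonoidMorphism.Build _ _
  (weyl_inD n u) (presMap1 weyl_inD_rel, presMapM weyl_inD_rel).
HB.instance Definition _ := GRing.isLinear.Build K _ _ *:%R
  (skew_inB n u v) (presMap_linear skew_inB_rel).
HB.instance Definition _ := GRing.isMonoidMorphism.Build _ _
  (skew_inB n u v) (presMap1 skew_inB_rel, presMapM skew_inB_rel).
HB.instance Definition _ := GRing.isLinear.Build K _ _ *:%R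
  (weyl_inB n u v) (presMap_linear weyl_inB_rel).
HB.instance Definition _ := GRing.isMonoidMorphism.Build _ _
  (weyl_inB n u v) (presMap1 weyl_inB_rel, presMapM weyl_inB_rel).

Lemma skew_inD_gen (i : 'I_n) :
  skew_inD n u (pgen (skew_rel (@fgen K 'I_n)) i) = pgen (heckeD_rel n u) (inl i).
Proof. exact: presMap_gen skew_inD_rel i. Qed.

Lemma weyl_inD_gen (i : 'I_n) :
  weyl_inD n u (pgen (spinD_rel (@fgen K 'I_n)) i) = pgen (heckeD_rel n u) (inr i).
Proof. exact: presMap_gen weyl_inD_rel i. Qed.

Lemma skew_inB_gen (i : 'I_n) :
  skew_inB n u v (pgen (skew_rel (@fgen K 'I_n)) i) = pgen (heckeB_rel n u v) (inl i).
Proof. exact: presMap_gen skew_inB_rel i. Qed.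

Lemma weyl_inB_gen (i : 'I_n) :
  weyl_inB n u v (pgen (spinB_rel (@fgen K 'I_n)) i) = pgen (heckeB_rel n u v) (inr i).
Proof. exact: presMap_gen weyl_inB_rel i. Qed.

End Embeddings.

(* Main.v *)
(* Let S = C[b_1, ..., b_n] and A = CW^-. The inverse of the multiplication map
   is h |-> h . (1 (x) 1) for a suitable action of the Hecke algebra on
   S (x) A, so no basis of either factor is needed. There b_j acts by left
   multiplication on S, and t_i by the operator T_i determined by
     T_i (1 (x) w) = 1 (x) t_i w,   T_i b_j = - b_(s_i j) T_i + c_i(j),
   where s_i is a transposition (or the identity, for t_n in type B) and c_i is
   a scalar supported on the indices of the root of t_i. These rules are
   compatible with b_j b_k = - b_k b_j, so T_i exists. A relation of CW^- holds
   for the T_i because both of its sides commute past the b_j by the same rule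
   and agree on 1 (x) A. *)
From HB Require Import structures.
Require Import Defs.
From mathcomp Require Import all_boot all_order all_algebra all_fingroup.
From mathcomp Require Import generic_quotient finmap monalg zify.
From mathcomp Require Import reals complex.

Set Implicit Arguments.
Unset Strict Implicit.
Unset Printing Implicit Defensive.

Import GRing.Theory.
Local Open Scope ring_scope.

(** * Presented algebras acting on modules *)

(** Lets lemmas such as [linearN] apply to functions whose linearity is established only inside a
    proof. *)
Definition linear_bundle (K : pzRingType) (U V : lmodType K) (f : U -> V)
    (f_lin : linear f) : {linear U -> V} :=
  HB.pack_for {linear U -> V} f (GRing.isLinear.Build K U V *:%R f f_lin).

Section LinearExtension.
Variables (K : comNzRingType) (G : choiceType) (V : lmodType K) (h : G -> V).

Definition linExt (g : {malg K[G]}) : V := \sum_(k <- msupp g) g@_k *: h k.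

Lemma linExtEw (d : {fset G}) g : (msupp g `<=` d)%fset ->
  linExt g = \sum_(k <- d) g@_k *: h k.
Proof.
move=> le; rewrite /linExt (big_fset_incl _ le) // => k _ /mcoeff_outdom ->.
by rewrite scale0r.
Qed.

Fact linExt_linear : linear linExt.
Proof.
move=> c x y; pose d := (msupp x `|` msupp y)%fset.
have lex : (msupp x `<=` d)%fset by exact: fsubsetUl.
have ley : (msupp y `<=` d)%fset by exact: fsubsetUr.
have lez : (msupp (c *: x + y) `<=` d)%fset.
  apply: (fsubset_trans (msuppD_le _ _)); rewrite fsubUset ley andbT.
  exact: fsubset_trans (msuppZ_le _ _) lex.
rewrite (linExtEw lex) (linExtEw ley) (linExtEw lez) scaler_sumr -big_split /=.
by apply: eq_bigr => k _; rewrite mcoeffD mcoeffZ scalerDl scalerA.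
Qed.

HB.instance Definition _ :=
  GRing.isLinear.Build K {malg K[G]} V *:%R linExt linExt_linear.

Lemma linExtU k : linExt << k >> = h k.
Proof.
rewrite (linExtEw (d := [fset k]%fset)) ?msuppU_le // big_seq_fset1.
by rewrite mcoeffUU scale1r.
Qed.

End LinearExtension.

(** The single closure step [c *: x + y] has the shape of [linear], so linear identities pass
    through it at once. The inductions on presented algebras and tensors below follow the same
    pattern. *)
Lemma malg_ind (K : comNzRingType) (G : choiceType) (P : {malg K[G]} -> Prop) :
  P 0 -> (forall c x y, P x -> P y -> P (c *: x + y)) ->
  (forall k, P << k >>) -> forall x, P x.
Proof.
move=> P0 PD PU x; rewrite [x]monalgE; elim: (enum_fset _) => [|k l IHl].
  by rewrite big_nil.
rewrite big_cons (_ : << x@_k *g k >> = x@_k *: << k >>); first exact: PD.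
by apply/malgP => k'; rewrite mcoeffZ !mcoeffU mulr_natr.
Qed.

Section FreeAction.
Variables (K : comNzRingType) (X : choiceType) (V : lmodType K).
Variable T : X -> {linear V -> V}.

(** The last letter acts first, so concatenation of words becomes composition of operators. *)
Definition wordAct (v : V) (m : {fmonom X}) : V :=
  foldr (fun x w => T x w) v (fmonom_val m).

Definition freeAct (a : freeAlg K X) (v : V) : V := linExt (wordAct v) a.

Lemma wordAct_linear m : linear (wordAct^~ m).
Proof.
move=> c v w; rewrite /wordAct; elim: (fmonom_val m) => //= x l ->.
exact: linearP.
Qed.

Lemma freeAct_linear a : linear (freeAct a).
Proof.
move=> c v w; rewrite /freeAct /linExt scaler_sumr -big_split /=.
apply: eq_bigr => m _; rewrite wordAct_linear scalerDr.
by rewrite !scalerA mulrC.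
Qed.

Lemma freeAct1 v : freeAct 1 v = v.
Proof. by rewrite /freeAct linExtU /wordAct fm1. Qed.

Lemma freeAct_gen x v : freeAct (fgen K x) v = T x v.
Proof. by rewrite /freeAct linExtU /wordAct fmU. Qed.

Lemma freeAct0 v : freeAct 0 v = 0.
Proof. exact: linear0. Qed.

Lemma freeActN a v : freeAct (- a) v = - freeAct a v.
Proof. exact: linearN. Qed.

Lemma freeActD a b v : freeAct (a + b) v = freeAct a v + freeAct b v.
Proof. exact: linearD. Qed.

Lemma freeActZ c a v : freeAct (c *: a) v = c *: freeAct a v.
Proof. exact: linearZ. Qed.

Lemma freeActr0 a : freeAct a 0 = 0.
Proof.
by have := freeAct_linear a (-1) 0 0; rewrite scaler0 addr0 scaleN1r addNr.
Qed.

Lemma freeActM a b v : freeAct (a * b) v = freeAct a (freeAct b v).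
Proof.
elim/malg_ind: a => [|c x y IHx IHy|k].
- by rewrite mul0r !freeAct0.
- rewrite mulrDl -scalerAl [LHS]freeActD freeActZ.
  by rewrite [RHS]freeActD freeActZ; congr (_ *: _ + _).
elim/malg_ind: b => [|c x y IHx IHy|k'].
- by rewrite mulr0 !freeAct0 freeActr0.
- rewrite mulrDr -freeAlg_scaleAr [LHS]freeActD freeActZ.
  rewrite [in RHS]freeActD freeActZ freeAct_linear.
  by congr (_ *: _ + _).
by rewrite malgM_def fgmulUU mulr1 /freeAct !linExtU /wordAct fmM foldr_cat.
Qed.

Variable r : freeAlg K X -> freeAlg K X -> Prop.

(* Meaningful when the operators T satisfy the relations r. *)
Definition presAct (p : presAlg r) (v : V) : V := freeAct (repr p) v.

Hypothesis T_rel : forall a b, r a b -> freeAct a =1 freeAct b.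

(** The elements that annihilate all of [V] form a two-sided ideal, and it contains every [a - b]
    with [r a b]. *)
Lemma freeAct_relIdeal a v : relIdeal r a -> freeAct a v = 0.
Proof.
(* The vector is generalised because [a * c] applies [a] to the image of [v] under [c]. *)
move=> Ia; elim: Ia v => {a}.
- by move=> a b /T_rel ab v; rewrite freeActD freeActN ab subrr.
- by move=> v; rewrite freeAct0.
- by move=> a b _ Ia _ Ib v; rewrite freeActD Ia Ib addr0.
- by move=> c a _ Ia v; rewrite freeActM Ia freeActr0.
- by move=> c a _ Ia v; rewrite freeActM Ia.
Qed.

Lemma presAct_pi a v : presAct (ppi r a) v = freeAct a v.
Proof.
have /(freeAct_relIdeal v) := ppi_repr_ideal r a.
by rewrite freeActD freeActN => /eqP; rewrite subr_eq0 => /eqP.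
Qed.

Lemma presAct_linear p : linear (presAct p).
Proof. exact: freeAct_linear. Qed.

Lemma presAct_linearl v : linear (presAct^~ v).
Proof.
move=> c p q; rewrite -[p]ppi_repr -[q]ppi_repr -ppiZ -ppiD !presAct_pi.
by rewrite freeActD freeActZ.
Qed.

Lemma presAct1 v : presAct 1 v = v.
Proof. by rewrite -ppi1 presAct_pi freeAct1. Qed.

Lemma presActM p q v : presAct (p * q) v = presAct p (presAct q v).
Proof.
by rewrite -[p]ppi_repr -[q]ppi_repr -ppiM !presAct_pi freeActM.
Qed.

Lemma presAct_gen x v : presAct (pgen r x) v = T x v.
Proof. by rewrite presAct_pi freeAct_gen. Qed.

End FreeAction.

Lemma presAlg_ind (K : comNzRingType) (X : choiceType)
    (r : freeAlg K X -> freeAlg K X -> Prop) (P : presAlg r -> Prop) :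
  P 1 -> (forall c p q, P p -> P q -> P (c *: p + q)) ->
  (forall x p, P p -> P (pgen r x * p)) -> forall p, P p.
Proof.
move=> P1 PD PM p; rewrite -[p]ppi_repr.
(* Zero is obtained as the combination [-1 *: 1 + 1]. *)
have P0 : P 0 by rewrite -(addNr 1) -scaleN1r; exact: PD.
elim/malg_ind: (repr p) => [|c x y Px Py|k]; first by rewrite ppi0.
  by rewrite ppiD ppiZ; exact: PD.
case: k => l; elim: l => [|x l IHl].
  rewrite (_ : FMonom [::] = mone); first exact: P1.
  by apply/val_inj; rewrite /= fm1.
rewrite (_ : << FMonom (x :: l) >> = fgen K x * << FMonom l >>).
  by rewrite ppiM; exact: PM.
rewrite malgM_def fgmulUU mulr1; congr << _ >>.
by apply/val_inj; rewrite /= fmM fmU.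
Qed.

(** * Induction on tensors and the universal property *)

Section TensorLift.
Variables (K : comNzRingType) (A B V : lmodType K).

Lemma tensor_ind (P : tensor A B -> Prop) :
  (forall c x y, P x -> P y -> P (c *: x + y)) ->
  (forall a b, P (tens a b)) -> forall x, P x.
Proof.
move=> PD Pt x; rewrite -[x]tpi_repr.
elim/malg_ind: (repr x) => [|c y z Py Pz|[a b]]; last exact: Pt.
- have := PD (-1) _ _ (Pt 0 0) (Pt 0 0); rewrite scaleN1r addNr.
  by rewrite (_ : tpi 0 = 0) // -(scale0r (tpi 0)) -tpiZ scale0r.
- by rewrite tpiD tpiZ; exact: PD.
Qed.

(** The conclusion is a sigma type, so that operators can later be defined by projecting from it. *)
Lemma tensor_lift (g : A -> B -> V) :
  (forall b, linear (g^~ b)) -> (forall a, linear (g a)) ->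
  {L : {linear tensor A B -> V} | forall a b, L (tens a b) = g a b}.
Proof.
move=> gl gr; 
pose h : {linear {malg K[(A * B)%type]} -> V} := linExt (fun k => g k.1 k.2).
have hU a b : h << (a, b) >> = g a b by exact: linExtU.
have gl0 b : g 0 b = 0.
  by have := gl b (-1) 0 0; rewrite scaler0 addr0 scaleN1r addNr.
have gr0 a : g a 0 = 0.
  by have := gr a (-1) 0 0; rewrite scaler0 addr0 scaleN1r addNr.
(* The linear extension kills the bilinearity relations, hence its value on a class does not depend
   on the representative. *)
have h_null x : tensorNull x -> h x = 0.
  elim=> {x} [a a' b|a b b'|c a b|c a b||x y _ hx _ hy|c x _ hx].
  - rewrite linearB linearD !hU.
    by rewrite -[a in g (a + _)]scale1r gl scale1r subrr.
  - rewrite linearB linearD !hU.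
    by rewrite -[b in g _ (b + _)]scale1r gr scale1r subrr.
  - rewrite linearB linearZ /= !hU.
    by rewrite -[c *: a]addr0 gl gl0 addr0 subrr.
  - rewrite linearB linearZ /= !hU.
    by rewrite -[c *: b]addr0 gr gr0 addr0 subrr.
  - exact: linear0.
  - by rewrite linearD hx hy addr0.
  - by rewrite linearZ /= hx scaler0.
pose f (x : tensor A B) := h (repr x).
have f_pi x : f (tpi x) = h x.
  apply/eqP; rewrite -subr_eq0 -linearB; apply/eqP/h_null.
  by apply/tpi_eq; rewrite tpi_repr.
have f_lin : linear f.
  move=> c x y; rewrite -[x]tpi_repr -[y]tpi_repr -tpiZ -tpiD !f_pi.
  exact: linearP.
exists (linear_bundle f_lin) => a b.
by rewrite -hU; exact: f_pi.
Qed.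

End TensorLift.

(** * Operators twisting the anticommuting variables *)

Lemma linearNZ (K : pzRingType) (U V : lmodType K) (f : {linear U -> V}) a x y :
  f (- x + a *: y) = - f x + a *: f y.
Proof. by rewrite addrC linearP linearN addrC. Qed.

Definition anticommuting n (V : zmodType) (B : 'I_n -> V -> V) :=
  forall i j x, i != j -> B i (B j x) = - B j (B i x).

Lemma freeAct_skew_rel (K : comNzRingType) n (X : choiceType) (V : lmodType K)
    (T : X -> {linear V -> V}) (g : 'I_n -> freeAlg K X) (B : 'I_n -> V -> V) :
  (forall i, freeAct T (g i) =1 B i) -> anticommuting B ->
  forall x y, skew_rel g x y -> freeAct T x =1 freeAct T y.
Proof.
move=> gB Banti _ _ [i j ij] v; rewrite [LHS]freeActD [X in X + _]freeActM.
rewrite [X in _ + X]freeActM !gB [RHS]freeAct0.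
by rewrite [X in X + _]Banti // addNr.
Qed.

Section TwistingOperators.
Variables (K : comNzRingType) (n : nat) (V : lmodType K).
Variable B : 'I_n -> {linear V -> V}.

Definition twisting (s : {perm 'I_n}) (c : 'I_n -> K) (T : V -> V) :=
  forall j x, T (B j x) = - B (s j) (T x) + c j *: x.

(** The case [p = q] is allowed: it serves [t_n] in type B, where [tperm p p] is the identity and
    the support is one index. *)
Definition rootCoef (p q : 'I_n) (u : K) (j : 'I_n) : K :=
  if (j == p) || (j == q) then u else 0.

Hypothesis B_anticomm : anticommuting B.

Section TwistedDerivation.
Variables (p q : 'I_n) (u : K).

(* Acting on pairs by [[- b_(s j), c j], [0, b_j]] turns the twisted derivation
   b_j |-> c j into an algebra morphism. *)
Definition pairOp j (x : V * V) : V * V :=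
  (- B (tperm p q j) x.1 + rootCoef p q u j *: x.2, B j x.2).

Fact pairOp_linear j : linear (pairOp j).
Proof.
move=> c x y; rewrite /pairOp; congr (_, _) => /=; last exact: linearP.
by rewrite linearP opprD !scalerDr scalerN !scalerA (mulrC _ c) addrACA.
Qed.

HB.instance Definition _ j :=
  GRing.isLinear.Build K (V * V)%type (V * V)%type *:%R (pairOp j)
    (pairOp_linear j).

(** This is the upper-right entry of the anticommutator of [pairOp i] and [pairOp j]. An index
    outside the root has coefficient zero and is fixed by the transposition; if both indices lie in
    the root, they are swapped and the two differences cancel. *)
Lemma rootCoef_anticomm i j (x : V) : i != j ->
  rootCoef p q u i *: (B j x - B (tperm p q j) x) +
  rootCoef p q u j *: (B i x - B (tperm p q i) x) = 0.
Proof.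
move=> ij; rewrite /rootCoef.
have root_eq k : ((k == p) || (k == q) = false) -> tperm p q k = k.
  by move=> /norP[kp kq]; rewrite tpermD // eq_sym.
case: ifP => [iE|/root_eq->]; last by rewrite subrr scaler0 scale0r addr0.
case: ifP => [jE|/root_eq->]; last by rewrite subrr scaler0 scale0r addr0.
rewrite -scalerDr; suff [-> ->]: tperm p q j = i /\ tperm p q i = j.
  by rewrite addrA subrK subrr scaler0.
case/orP: iE ij => /eqP->; case/orP: jE => /eqP->; rewrite ?eqxx //.
  by rewrite tpermR tpermL.
by rewrite tpermR tpermL.
Qed.

Lemma pairOp_anticomm : anticommuting pairOp.
Proof.
move=> i j x ij; rewrite /pairOp; congr (_, _) => /=; last exact: B_anticomm.
have sij : tperm p q i != tperm p q j by rewrite (inj_eq perm_inj).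
rewrite !(linearNZ (B _)) (B_anticomm _ sij) [RHS]opprD !opprK opprD -!addrA.
apply/eqP; rewrite (inj_eq (addrI _)) -subr_eq0 opprB; apply/eqP.
rewrite -[RHS](rootCoef_anticomm x.2 ij) !scalerBr.
by rewrite [X in X + _]addrC [X in _ + X]addrC addrACA [X in _ + X]addrC.
Qed.

Lemma freeAct_pairOp_rel x y : skew_rel (@fgen K 'I_n) x y ->
  freeAct pairOp x =1 freeAct pairOp y.
Proof.
apply: freeAct_skew_rel pairOp_anticomm _ _ => i v.
exact: (freeAct_gen pairOp).
Qed.

End TwistedDerivation.

(** * Extending relations from the generators [e w] to all of [V] *)

Section Relations.
Variables (W : Type) (e : W -> V).
Hypothesis V_ind : forall P : V -> Prop,
  (forall c x y, P x -> P y -> P (c *: x + y)) ->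
  (forall w, P (e w)) -> (forall j x, P x -> P (B j x)) -> forall x, P x.

Variables (T U : {linear V -> V}) (s t : {perm 'I_n}) (a d : 'I_n -> K).
Hypotheses (Ttw : twisting s a T) (Utw : twisting t d U).

(** Moving [T] twice past [B j] leaves the scalar term [(a j - a (s j)) *: T x], which vanishes. *)
Lemma twisting_sq : (forall j, s (s j) = j) -> (forall j, a (s j) = a j) ->
  (forall w, T (T (e w)) = e w) -> forall x, T (T x) = x.
Proof.
move=> ss as_ Te; apply: V_ind => // [c x y Tx Ty|j x Tx].
  by rewrite !linearP Tx Ty.
by rewrite Ttw (linearNZ T) Ttw Tx ss as_ opprD opprK subrK.
Qed.

Hypotheses (TT : forall x, T (T x) = x) (UU : forall x, U (U x) = x).

(** Past [B j], both sides produce the same scalar terms [d j *: T x - a j *: U x]. *)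
Lemma twisting_far : (forall j, s (t j) = t (s j)) ->
  (forall j, a (t j) = a j) -> (forall j, d (s j) = d j) ->
  (forall w, T (U (e w)) = - U (T (e w))) -> forall x, T (U x) = - U (T x).
Proof.
move=> st at_ ds TUe; apply: V_ind => // [c x y Px Py|j x Px].
  by rewrite !linearP Px Py.
rewrite Utw Ttw (linearNZ T) (linearNZ U) Utw Ttw Px st at_ ds.
rewrite [B _ (- _)]linearN !opprD !opprK.
by rewrite -!addrA; congr (_ + _); rewrite addrC.
Qed.

(** The three scalar conditions match, in order, the coefficients of [U (T x)], of [x] and of
    [T (U x)]. The term in [x] comes from [T (T x)] on one side and from [U (U x)] on the other. *)
Lemma twisting_braid : (forall j, s (t (s j)) = t (s (t j))) ->
  (forall j, a (t (s j)) = d j) -> (forall j, d (s j) = a (t j)) ->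
  (forall j, a j = d (s (t j))) ->
  (forall w, T (U (T (e w))) = U (T (U (e w)))) ->
  forall x, T (U (T x)) = U (T (U x)).
Proof.
move=> sts ats ds dst Te; apply: V_ind => // [c x y Px Py|j x Px].
  by rewrite !linearP Px Py.
rewrite Ttw Utw !(linearNZ T, linearNZ U) Ttw Utw !linearD !linearN !linearZ /=.
rewrite !opprK Ttw Utw TT UU Px sts ats ds -dst -!addrA; congr (_ + _).
by rewrite addrC -addrA [RHS]addrCA.
Qed.

(** As [t] fixes every index, [T U] and [U T] both carry [B k] to [B (s k)], up to terms in [T] and
    [U]. After a second pass and cancellation of squares, the lower terms of the two fourfold
    products are opposite. *)
Lemma twisting_B4 : (forall j, t j = j) ->  (forall j, s (s j) = j) ->
  (forall j, a (s j) = a j) ->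
  (forall w, T (U (T (U (e w)))) = - U (T (U (T (e w))))) ->
  forall x, T (U (T (U x))) = - U (T (U (T x))).
Proof.
move=> t1 ss as_ Te; apply: V_ind => // [c x y Px Py|j x Px].
  by rewrite !linearP Px Py.
have TU k y : T (U (B k y)) = B (s k) (T (U y)) + (d k *: T y - a k *: U y).
  by rewrite Utw t1 (linearNZ T) Ttw opprD opprK -addrA [- _ + _]addrC.
have UT k y : U (T (B k y)) = B (s k) (U (T y)) - (d (s k) *: T y - a k *: U y).
  by rewrite Ttw (linearNZ U) Utw t1 opprD opprK opprB -addrA [- _ + _]addrC.
have TUB k l y z : T (U (k *: y - l *: z)) = k *: T (U y) - l *: T (U z).
  by rewrite (linearB U) (linearB T) !linearZ.
have UTB k l y z : U (T (k *: y - l *: z)) = k *: U (T y) - l *: U (T z).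
  by rewrite (linearB T) (linearB U) !linearZ.
rewrite TU (linearD U) (linearD T) TU TUB UT (linearB T) (linearB U) UT UTB.
rewrite !TT !UU !ss as_ Px (linearN (B _)) !opprD !opprK.
by rewrite -[LHS]addrA -[RHS]addrA; congr (_ + _); rewrite addrC.
Qed.
End Relations.
End TwistingOperators.

(** * The action on the tensor product *)

Section LinearClosure.
Variables (K : comNzRingType) (V W : lmodType K).

Lemma anticomm_linearP (f g : {linear V -> V}) c x y :
  f (g x) = - g (f x) -> f (g y) = - g (f y) ->
  f (g (c *: x + y)) = - g (f (c *: x + y)).
Proof. by move=> fgx fgy; rewrite !linearP fgx fgy. Qed.

Lemma twisting_linearP (f g h : {linear V -> V}) a c x y :
  f (g x) = - h (f x) + a *: x -> f (g y) = - h (f y) + a *: y ->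
  f (g (c *: x + y)) = - h (f (c *: x + y)) + a *: (c *: x + y).
Proof.
move=> fgx fgy; rewrite (linearP g) !(linearP f) fgx fgy (linearP h).
by rewrite opprD !scalerDr scalerN !scalerA (mulrC c) addrACA.
Qed.

Lemma intertwine_linearP (f : {linear V -> V}) (m : {linear V -> W})
    (l : W -> W) c x y : linear l -> m (f x) = l (m x) -> m (f y) = l (m y) ->
  m (f (c *: x + y)) = l (m (c *: x + y)).
Proof. by move=> l_lin fx fy; rewrite !linearP fx fy l_lin. Qed.

Lemma cancel_linearP (m : {linear V -> W}) (l : W -> V) c x y :
  linear l -> l (m x) = x -> l (m y) = y -> l (m (c *: x + y)) = c *: x + y.
Proof. by move=> l_lin lx ly; rewrite linearP l_lin lx ly. Qed.

End LinearClosure.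

(* An abstract tensor product: the concrete one has operations that the unifier
   would unfold endlessly. *)
Record tensorProduct (K : comNzRingType) (A B V : lmodType K)
    (tau : A -> B -> V) := TensorProduct {
  tauPl : forall b, linear (tau^~ b);
  tauPr : forall a, linear (tau a);
  tau_ind : forall P : V -> Prop,
    (forall c x y, P x -> P y -> P (c *: x + y)) ->
    (forall a b, P (tau a b)) -> forall x, P x;
  tau_lift : forall (W : lmodType K) (g : A -> B -> W),
    (forall b, linear (g^~ b)) -> (forall a, linear (g a)) ->
    {L : {linear V -> W} | forall a b, L (tau a b) = g a b} }.

(** * Multiplication by the [b_j] and existence of the twisting operators *)

Section SkewTensor.
Variables (K : comNzRingType) (n : nat) (Y : choiceType).
Variable rA : freeAlg K Y -> freeAlg K Y -> Prop.
Local Notation rS := (skew_rel (@fgen K 'I_n)).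
Local Notation S := (presAlg rS).
Local Notation A := (presAlg rA).
Variables (V : lmodType K) (tau : S -> A -> V).
Hypothesis tauP : tensorProduct tau.

Fact mulB_exists j : {L : {linear V -> V} |
  forall f w, L (tau f w) = tau (pgen rS j * f) w}.
Proof.
apply: (tau_lift tauP) => [w c x y|g c x y]; last exact: tauPr tauP _ _ _ _.
by rewrite mulrDr -[_ * (c *: x)]presAlg_scaleAr (tauPl tauP).
Qed.

Definition mulB j : {linear V -> V} := sval (mulB_exists j).

Lemma mulB_tau j f w : mulB j (tau f w) = tau (pgen rS j * f) w.
Proof. exact: (svalP (mulB_exists j)). Qed.

Lemma skew_gen_anticomm (i j : 'I_n) : i != j ->
  pgen rS i * pgen rS j = - (pgen rS j * pgen rS i).
Proof.
move=> ij; apply/eqP; rewrite -addr_eq0; apply/eqP.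
have := presAlg_rel (skew_anticomm (@fgen K 'I_n) ij).
by rewrite ppi0 [LHS]ppiD [X in X + _]ppiM [X in _ + X]ppiM.
Qed.

(** Supplies the hypothesis [V_ind] of the twisting lemmas, with [e := tau 1]. *)
Lemma skew_tensor_ind (P : V -> Prop) :
  (forall c x y, P x -> P y -> P (c *: x + y)) ->
  (forall w, P (tau 1 w)) -> (forall j x, P x -> P (mulB j x)) ->
  forall x, P x.
Proof.
move=> PD P1 PB; apply: (tau_ind tauP); first exact: PD.
move=> f w; elim/presAlg_ind: f => [|c p q Pp Pq|j p Pp]; first exact: P1.
- rewrite (tauPl tauP); exact: PD.
- rewrite -mulB_tau; exact: PB.
Qed.

Lemma mulB_anticomm : anticommuting mulB.
Proof.
move=> i j x ij; elim/(tau_ind tauP): x => [c x y|f w].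
  exact: anticomm_linearP.
rewrite !mulB_tau !mulrA skew_gen_anticomm // mulNr.
exact: (linearN (linear_bundle (tauPl tauP w))).
Qed.

(** The value of [T] at [tau f w] is the first component of [f] acting through [pairOp] on the pair
    [(tau 1 (a * w), tau 1 w)]. *)
Lemma twisting_exists (p q : 'I_n) (u : K) (a : A) :
  {T : {linear V -> V} | twisting mulB (tperm p q) (rootCoef p q u) T
   & forall w, T (tau 1 w) = tau 1 (a * w)}.
Proof.
pose ops := pairOp mulB p q u; pose act (f : S) z := presAct ops f z.
have rel := @freeAct_pairOp_rel _ _ _ _ mulB_anticomm p q u.
have act_lin f : linear (act f) := presAct_linear (pairOp mulB p q u) f.
have [w c x y|f c x y|T TE] := tau_lift tauP
  (g := fun f w => (act f (tau 1 (a * w), tau 1 w)).1).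
- by rewrite /act presAct_linearl.
- have /= <- := congr1 fst (act_lin f c (tau 1 (a * x), tau 1 x)
    (tau 1 (a * y), tau 1 y)).
  rewrite /act; congr (presAct _ _ _).1; congr (_, _).
    by rewrite mulrDr -[a * (c *: x)]presAlg_scaleAr (tauPr tauP).
  by rewrite (tauPr tauP).
(* The second component just records [tau f w]; it provides the vector in the scalar term of the
   twisting rule. *)
have act2 f w z : (act f (z, tau 1 w)).2 = tau f w.
  elim/presAlg_ind: f => [|c f g IHf IHg|j f IHf].
  - by rewrite /act presAct1.
  - rewrite /act presAct_linearl //= -/(act f _) -/(act g _) IHf IHg.
    by rewrite (tauPl tauP).
  - by rewrite /act presActM // presAct_gen //= -/(act f _) IHf mulB_tau.
exists T => [j x|w]; last by rewrite TE /act presAct1.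
elim/(tau_ind tauP): x => [c x y|f w]; first exact: twisting_linearP.
rewrite mulB_tau !TE /act presActM // presAct_gen //=.
by rewrite -/(act f _) act2.
Qed.

End SkewTensor.

(** * Bijectivity of multiplication, with [tperm i (q i)] as the permutation of [t_i] *)

Section Multiplication.
Variables (K : comNzRingType) (n : nat).
Variables (q : 'I_n -> 'I_n) (u : 'I_n -> K).
Local Notation rS := (skew_rel (@fgen K 'I_n)).
Variable rA : freeAlg K 'I_n -> freeAlg K 'I_n -> Prop.
Local Notation X := ('I_n + 'I_n)%type.
Variable rH : freeAlg K X -> freeAlg K X -> Prop.
Local Notation S := (presAlg rS).
Local Notation A := (presAlg rA).
Local Notation H := (presAlg rH).
Variables (V : lmodType K) (tau : S -> A -> V).
Hypothesis tauP : tensorProduct tau.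

Hypothesis inS_rel : forall x y, rS x y -> rH (freeMap inl x) (freeMap inl y).
Hypothesis inA_rel : forall x y, rA x y -> rH (freeMap inr x) (freeMap inr y).
Local Notation b j := (pgen rH (inl j)).
Local Notation t i := (pgen rH (inr i)).
Hypothesis cross : forall i j,
  t i * b j = - (b (tperm i (q i) j) * t i) +
              rootCoef i (q i) (u i) j *: (1 : H).

Definition twistOp (i : 'I_n) : {linear V -> V} :=
  s2val (twisting_exists tauP i (q i) (u i) (pgen rA i)).

Lemma twistOp_twisting i : twisting (mulB tauP)
  (tperm i (q i)) (rootCoef i (q i) (u i)) (twistOp i).
Proof. exact: (s2valP (twisting_exists tauP i (q i) (u i) (pgen rA i))). Qed.

Lemma twistOp1 i w :
  twistOp i (tau 1 w) = tau 1 (pgen rA i * w).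
Proof. exact: (s2valP' (twisting_exists tauP i (q i) (u i) (pgen rA i))). Qed.

Definition heckeOp (x : X) : {linear V -> V} :=
  match x with inl j => mulB tauP j | inr i => twistOp i end.

Hypothesis heckeOp_rel : forall x y, rH x y ->
  freeAct heckeOp x =1 freeAct heckeOp y.

Local Notation inS := (presMap rS rH inl).
Local Notation inA := (presMap rA rH inr).

Fact mulH_spec :
  {m : {linear V -> H} | forall f w, m (tau f w) = inS f * inA w}.
Proof.
apply: (tau_lift tauP) => [w c x y|f c x y].
  by rewrite (presMap_linear inS_rel) mulrDl -presAlg_scaleAl.
by rewrite (presMap_linear inA_rel) mulrDr -presAlg_scaleAr.
Qed.

(** The map [m] intertwines the action with left multiplication, so acting by [h] on [tau 1 1] and
    applying [m] returns [h]. Conversely [inA w] sends [tau 1 1] to [tau 1 w], which [inS f] sends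
    to [tau f w]. *)
Lemma mul_bijective :
  exists2 m : {linear V -> H}, forall f w, m (tau f w) = inS f * inA w
                             & bijective m.
Proof.
have [m mE] := mulH_spec; exists m => //.
have mulH_linear h c (x y : H) : h * (c *: x + y) = c *: (h * x) + h * y.
  by rewrite mulrDr -presAlg_scaleAr.
have m_b j v : m (mulB tauP j v) = b j * m v.
  elim/(tau_ind tauP): v => [c x y|f w].
    exact: (@intertwine_linearP K V H (mulB tauP j) m _ c x y
      (mulH_linear (b j))).
  by rewrite mulB_tau !mE (presMapM inS_rel) (presMap_gen inS_rel) mulrA.
(* The operator is known only on [tau 1 w] and through its twisting rule, so the induction runs over
   the [b_j]; [cross] is the same rule inside [H]. *)
have m_t i v : m (twistOp i v) = t i * m v.
  elim/(skew_tensor_ind (tauP := tauP)): v => [c x y|w|j x Px].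
  - exact: (@intertwine_linearP K V H (twistOp i) m _ c x y
      (mulH_linear (t i))).
  - rewrite twistOp1 (mE 1 w) (mE 1) (presMapM inA_rel) (presMap_gen inA_rel).
    by rewrite (presMap1 inS_rel) (mul1r (inA w)) [LHS]mul1r.
  - rewrite (twistOp_twisting i) (linearNZ m) (m_b j) (m_b _ (twistOp i x)) Px.
    rewrite [RHS]mulrA cross [RHS]mulrDl -presAlg_scaleAl mul1r mulNr.
    by rewrite mulrA.
have m_op x v : m (heckeOp x v) = pgen rH x * m v by case: x => i /=.
have m_act h v : m (presAct heckeOp h v) = h * m v.
  elim/presAlg_ind: h v => [|c g h IHg IHh|x h IHh] v.
  - by rewrite (presAct1 heckeOp_rel) mul1r.
  - rewrite (presAct_linearl heckeOp_rel) (linearP m) IHg IHh.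
    by rewrite mulrDl -presAlg_scaleAl.
  - by rewrite (presActM heckeOp_rel) (presAct_gen heckeOp_rel) m_op IHh mulrA.
have act_A w : presAct heckeOp (inA w) (tau 1 1) = tau 1 w.
  elim/presAlg_ind: w => [|c x y IHx IHy|i w IHw].
  - by rewrite (presMap1 inA_rel) (presAct1 heckeOp_rel).
  - rewrite (presMap_linear inA_rel) (presAct_linearl heckeOp_rel) (tauPr tauP).
    by congr (_ *: _ + _); [exact: IHx | exact: IHy].
  - rewrite (presMapM inA_rel) (presMap_gen inA_rel) (presActM heckeOp_rel) IHw.
    by rewrite (presAct_gen heckeOp_rel) /= twistOp1.
have act_S f w : presAct heckeOp (inS f) (tau 1 w) = tau f w.
  elim/presAlg_ind: f => [|c x y IHx IHy|i f IHf].
  - by rewrite (presMap1 inS_rel) (presAct1 heckeOp_rel).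
  - rewrite (presMap_linear inS_rel) (presAct_linearl heckeOp_rel) (tauPl tauP).
    by congr (_ *: _ + _); [exact: IHx | exact: IHy].
  - rewrite (presMapM inS_rel) (presMap_gen inS_rel) (presActM heckeOp_rel) IHf.
    by rewrite (presAct_gen heckeOp_rel) /= mulB_tau.
exists (fun h => presAct heckeOp h (tau 1 1)) => [v|h].
  elim/(tau_ind tauP): v => [c x y|f w].
    exact: (@cancel_linearP K V H m (fun h => presAct heckeOp h (tau 1 1)) c x y
      (presAct_linearl heckeOp_rel _)).
  rewrite (mE f w) (presActM heckeOp_rel (inS f) (inA w)).
  exact: etrans (congr1 (presAct heckeOp (inS f)) (act_A w)) (act_S f w).
rewrite (m_act h) (mE 1 1) (presMap1 inS_rel) (presMap1 inA_rel).
by rewrite [X in h * X]mulr1 [LHS]mulr1.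
Qed.

End Multiplication.

(** * Relations between the twisting operators *)

Section RootCoef.
Variables (K : comNzRingType) (n : nat) (u : K).
Implicit Types p q r s x y z j : 'I_n.

Lemma rootCoefK p q v j : rootCoef p q v (tperm p q j) = rootCoef p q v j :> K.
Proof.
rewrite /rootCoef; case: tpermP => [->|->|//]; rewrite !eqxx ?orbT //.
Qed.

Lemma rootCoef_far p q r s j : p != r -> p != s -> q != r -> q != s ->
  rootCoef p q u (tperm r s j) = rootCoef p q u j.
Proof.
move=> pr ps qr qs; rewrite /rootCoef.
case: tpermP => [->|->|//]; rewrite ![_ == p]eq_sym ![_ == q]eq_sym.
  by rewrite !(negbTE ps) !(negbTE qs) !(negbTE pr) !(negbTE qr).
by rewrite !(negbTE ps) !(negbTE qs) !(negbTE pr) !(negbTE qr).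
Qed.

Lemma tperm_far p q r s j : p != r -> p != s -> q != r -> q != s ->
  tperm p q (tperm r s j) = tperm r s (tperm p q j).
Proof.
move=> pr ps qr qs; have [jr|jr] := eqVneq j r.
  by rewrite jr tpermL [tperm p q r]tpermD ?tpermL // tpermD.
have [js|js] := eqVneq j s.
  by rewrite js tpermR [tperm p q s]tpermD ?tpermR // tpermD.
rewrite (@tpermD _ r s j) 1?eq_sym //.
by case: (tpermP p q j) => [_|_|_ _]; rewrite tpermD // eq_sym.
Qed.

Section Braid.
Variables x y z : 'I_n.
Hypotheses (xy : x != y) (yz : y != z) (xz : x != z).

Let simp := (eqxx, negbTE xy, negbTE yz, negbTE xz, eq_sym y x, eq_sym z y,
  eq_sym z x, tpermL, tpermR).

Let neqs' : (y != x) * (z != y) * (z != x).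
Proof. by rewrite ![_ == x]eq_sym [z == y]eq_sym xy yz xz. Qed.
Let txyz : tperm x y z = z. Proof. by rewrite tpermD. Qed.
Let tyzx : tperm y z x = x. Proof. by rewrite tpermD // neqs'. Qed.

Lemma tperm_braid j : tperm x y (tperm y z (tperm x y j)) =
  tperm y z (tperm x y (tperm y z j)).
Proof.
have [->|jx] := eqVneq j x; first by rewrite tpermL !tyzx !tpermL txyz.
have [->|jy] := eqVneq j y; first by rewrite tpermR tyzx !tpermL txyz tpermR.
have [->|jz] := eqVneq j z; first by rewrite txyz !tpermR tyzx.
have [xj yj zj] : [/\ x != j, y != j & z != j] by rewrite ![_ == j]eq_sym.
by rewrite !tpermD.
Qed.

(** These are the scalar conditions of [twisting_braid] for the transpositions of [{x, y}] and
    [{y, z}]. The product of the two transpositions, in the suitable order, carries one root onto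
    the other, and both sides of the middle equation are supported on [{x, z}]. *)
Lemma rootCoef_braid j :
  [/\ rootCoef x y u (tperm y z (tperm x y j)) = rootCoef y z u j,
      rootCoef y z u (tperm x y j) = rootCoef x y u (tperm y z j)
    & rootCoef x y u j = rootCoef y z u (tperm x y (tperm y z j))].
Proof.
rewrite /rootCoef.
have [->|jx] := eqVneq j x.
  by rewrite tpermL !tyzx tpermL !simp.
have [->|jy] := eqVneq j y.
  by rewrite tpermR tpermL tyzx txyz !simp.
have [->|jz] := eqVneq j z.
  by rewrite txyz !tpermR !simp.
have [xj yj zj] : [/\ x != j, y != j & z != j] by rewrite ![_ == j]eq_sym.
by rewrite !tpermD // (negbTE jx) (negbTE jy) (negbTE jz).
Qed.
End Braid.
End RootCoef.

(** * Sign rules for products of two involutions in a ring *)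

Section RingIdentities.
Variables (R : pzRingType) (a b : R).
Hypotheses (aa : a * a = 1) (bb : b * b = 1).

Let abba : a * b * (b * a) = 1.
Proof. by rewrite mulrA -[a * b * b]mulrA bb mulr1. Qed.

(** The inverse of [a * b] is [b * a], so the square being [-1] forces [a * b = - (b * a)]. The
    trailing [c] fits the iterated left multiplications on [tau 1 w]. *)
Lemma anticomm_of_sq c : (a * b) ^+ 2 = -1 -> a * (b * c) = - (b * (a * c)).
Proof.
rewrite expr2 => ab2; rewrite !mulrA -mulNr; congr (_ * c).
by rewrite -[LHS]mulr1 -abba mulrA ab2 mulN1r.
Qed.

Lemma anticomm_of_exp4 c : (a * b) ^+ 4 = -1 ->
  a * (b * (a * (b * c))) = - (b * (a * (b * (a * c)))).
Proof.
rewrite (exprM _ 2 2) !expr2 => ab4.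
have abab : a * b * (a * b) * (b * a * (b * a)) = 1.
  by rewrite mulrA -[a * b * (a * b) * _]mulrA abba mulr1.
have abab_opp : a * b * (a * b) = - (b * a * (b * a)).
  by rewrite -[LHS]mulr1 -abab mulrA ab4 mulN1r.
by rewrite -!mulNr !mulrA -(mulrA (a * b)) abab_opp !mulNr !mulrA.
Qed.
Lemma twist_flip x y d : a * x + y * a = d -> a * d = d * a ->
  a * y = - (x * a) + d.
Proof.
move=> E ad; have {}E : y * a = d - a * x by rewrite -E addrC addKr.
rewrite -[y]mulr1 -aa [y * _]mulrA E mulrA mulrBr mulrA aa mul1r mulrBl.
by rewrite ad -mulrA aa mulr1 addrC.
Qed.
End RingIdentities.

(** * Defining relations read in the presented algebra *)

Section PresentedGenerators.
Variables (K : comNzRingType) (X : choiceType) (n : nat).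
Variable r : freeAlg K X -> freeAlg K X -> Prop.
Variables g : 'I_n -> X.
Local Notation t i := (pgen r (g i)).
Local Notation f i := (fgen K (g i)).

(** The map [g] is [id] for the spin Weyl group algebra and [inr] for the Hecke algebra. *)
Lemma pgen_sq i : r (f i ^+ 2) 1 -> t i * t i = 1.
Proof. by move/presAlg_rel; rewrite expr2 ppiM. Qed.

Lemma pgen_braid i j : r (f i * f j * f i) (f j * f i * f j) ->
  t i * t j * t i = t j * t i * t j.
Proof.
move/presAlg_rel => E; etransitivity; last (etransitivity; first exact: E).
  by rewrite [RHS]ppiM [X in _ = X * _]ppiM.
by rewrite [LHS]ppiM [X in X * _ = _]ppiM.
Qed.

Lemma pgen_exp_opp i j m : r ((f i * f j) ^+ m) (-1) -> (t i * t j) ^+ m = -1.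
Proof.
move/presAlg_rel => E; etransitivity; last (etransitivity; first exact: E).
  elim: m {E} => [|m IHm]; first by rewrite !expr0.
  by rewrite !exprS IHm [RHS]ppiM [X in _ = X * _]ppiM.
by rewrite -scaleN1r ppiZ scaleN1r.
Qed.
End PresentedGenerators.

(** * Monomials in generators as composites of operators *)

Section FreeActGenerators.
Variables (K : comNzRingType) (X : choiceType) (V : lmodType K).
Variable T : X -> {linear V -> V}.
Implicit Types x y z : X.
Local Notation f := (fgen K).

Lemma freeActN1 v : freeAct T (-1) v = - v.
Proof. by rewrite freeActN freeAct1. Qed.

Lemma freeActZ1 c v : freeAct T (c *: 1) v = c *: v.
Proof. by rewrite freeActZ freeAct1. Qed.

Lemma freeAct_gen2 x y v : freeAct T (f x * f y) v = T x (T y v).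
Proof. by rewrite freeActM !freeAct_gen. Qed.

Lemma freeAct_gen3 x y z v : freeAct T (f x * f y * f z) v = T x (T y (T z v)).
Proof. by rewrite [LHS]freeActM freeAct_gen2 freeAct_gen. Qed.

Lemma freeAct_genX2 x y v :
  freeAct T ((f x * f y) ^+ 2) v = T x (T y (T x (T y v))).
Proof. by rewrite expr2 [LHS]freeActM !freeAct_gen2. Qed.

Lemma freeAct_genX4 x y v : freeAct T ((f x * f y) ^+ 4) v =
  T x (T y (T x (T y (T x (T y (T x (T y v))))))).
Proof. by rewrite (exprM _ 2 2) expr2 [LHS]freeActM !freeAct_genX2. Qed.

Lemma freeAct_genD x y z w v :
  freeAct T (f x * f y + f z * f w) v = T x (T y v) + T z (T w v).
Proof.
by rewrite [LHS]freeActD [X in X + _]freeAct_gen2 [X in _ + X]freeAct_gen2.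
Qed.

End FreeActGenerators.

Section TwistRelations.
Variables (K : comNzRingType) (n : nat).
Variables (q : 'I_n -> 'I_n) (u : 'I_n -> K).
Variable rA : freeAlg K 'I_n -> freeAlg K 'I_n -> Prop.
Local Notation S := (presAlg (skew_rel (@fgen K 'I_n))).
Local Notation A := (presAlg rA).
Variables (V : lmodType K) (tau : S -> A -> V).
Hypothesis tauP : tensorProduct tau.
Local Notation T := (twistOp q u tauP).
Local Notation B := (mulB tauP).
Local Notation t := (pgen rA).
Local Notation ind := (skew_tensor_ind (tauP := tauP)).

Hypothesis tt : forall i, t i * t i = 1.

(** Exchanging the two ends of a root lets the operator of [t_n] in type D be written with the index
    it shares with another root in the required place. *)
Lemma twistOpC i :
  twisting B (tperm (q i) i) (rootCoef (q i) i (u i)) (T i).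
Proof.
by move=> j x; rewrite (twistOp_twisting _ _ tauP) tpermC /rootCoef orbC.
Qed.

Lemma twistOp_sq i x : T i (T i x) = x.
Proof.
apply: (twisting_sq ind (twistOp_twisting q u tauP i)) => [j|j|w].
- exact: tpermK.
- exact: rootCoefK.
- by rewrite !twistOp1 mulrA tt mul1r.
Qed.

(** Permutations and coefficients are left general to cover both disjoint roots and, in type D, the
    two roots supported on the last two indices. *)
Lemma twistOp_far i j s r a d :
  twisting B s a (T i) -> twisting B r d (T j) ->
  (forall k, s (r k) = r (s k)) -> (forall k, a (r k) = a k) ->
  (forall k, d (s k) = d k) -> (t i * t j) ^+ 2 = -1 ->
  forall x, T i (T j x) = - T j (T i x).
Proof.
move=> Ti Tj sr ar ds tij2; have tij c := anticomm_of_sq (tt i) (tt j) c tij2.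
apply: (twisting_far ind Ti Tj) => // w.
rewrite !twistOp1 tij.
exact: (linearN (linear_bundle (tauPr tauP 1))).
Qed.

Lemma twistOp_braid i j x y z v : x != y -> y != z -> x != z ->
  twisting B (tperm x y) (rootCoef x y v) (T i) ->
  twisting B (tperm y z) (rootCoef y z v) (T j) ->
  t i * t j * t i = t j * t i * t j ->
  forall w, T i (T j (T i w)) = T j (T i (T j w)).
Proof.
move=> xy yz xz Ti Tj tij.
apply: (twisting_braid ind Ti Tj (twistOp_sq i) (twistOp_sq j)) => k.
- exact: tperm_braid.
- by case: (rootCoef_braid v xy yz xz k).
- by case: (rootCoef_braid v xy yz xz k).
- by case: (rootCoef_braid v xy yz xz k).
- by rewrite !twistOp1 !mulrA tij.
Qed.

Lemma twistOp_B4 i j : q j = j -> (t i * t j) ^+ 4 = -1 ->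
  forall x, T i (T j (T i (T j x))) = - T j (T i (T j (T i x))).
Proof.
move=> qj tij4; have tij c := anticomm_of_exp4 (tt i) (tt j) c tij4.
apply: (twisting_B4 ind (twistOp_twisting q u tauP i)
  (twistOp_twisting q u tauP j) (twistOp_sq i) (twistOp_sq j)) => [k|k|k|w].
- by rewrite qj tperm1 perm1.
- exact: tpermK.
- exact: rootCoefK.
- rewrite !twistOp1 tij.
  exact: (linearN (linear_bundle (tauPr tauP 1))).
Qed.

Local Notation op := (heckeOp q u tauP).
Local Notation fb j := (fgen K (inl j : 'I_n + 'I_n)).
Local Notation ft j := (fgen K (inr j : 'I_n + 'I_n)).

Lemma freeAct_cross_adj i j k : tperm i (q i) j = k -> (j == i) || (j == q i) ->
  freeAct op (ft i * fb j + fb k * ft i) =1 freeAct op (u i *: 1).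
Proof.
move=> <- jE v; rewrite freeActZ1 freeAct_genD /=.
by rewrite (twistOp_twisting q u tauP i) /rootCoef jE addrAC addNr add0r.
Qed.

Lemma freeAct_cross_far i j : j != i -> j != q i ->
  freeAct op (ft i * fb j) =1 freeAct op (- (fb j * ft i)).
Proof.
move=> ji jq v.
rewrite [RHS]freeActN [LHS]freeAct_gen2 [X in _ = - X]freeAct_gen2 /=.
rewrite (twistOp_twisting q u tauP i) /rootCoef (negbTE ji) (negbTE jq) /=.
by rewrite scale0r addr0 tpermD // eq_sym.
Qed.

End TwistRelations.

(** * The commutation rule of [t_i] and [b_j] inside the Hecke algebra *)

Section CrossRelations.
Variables (K : comNzRingType) (n : nat).
Local Notation X := ('I_n + 'I_n)%type.
Variable r : freeAlg K X -> freeAlg K X -> Prop.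
Local Notation b j := (pgen r (inl j)).
Local Notation t i := (pgen r (inr i)).
Local Notation fb j := (fgen K (inl j : X)).
Local Notation ft i := (fgen K (inr i : X)).

(* The relation for b_k t with k the other end of the root is obtained by
   multiplying the given one by t on both sides. *)
Lemma cross_of_rel i k u : t i * t i = 1 ->
  r (ft i * fb i + fb k * ft i) (u *: 1) ->
  (forall j, j != i -> j != k -> r (ft i * fb j) (- (fb j * ft i))) ->
  forall j, t i * b j = - (b (tperm i k j) * t i) +
    rootCoef i k u j *: (1 : presAlg r).
Proof.
move=> tt /presAlg_rel adj far j.
have {}adj : t i * b i + b k * t i = u *: (1 : presAlg r).
  etransitivity; last (etransitivity; first exact: adj); last by rewrite ppiZ.
  by rewrite [RHS]ppiD [X in _ = X + _]ppiM [X in _ = _ + X]ppiM.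
have [->|ji] := eqVneq j i.
  by rewrite tpermL /rootCoef eqxx -adj [RHS]addrC addrK.
have [->|jk] := eqVneq j k.
  rewrite tpermR /rootCoef eqxx orbT.
  apply: (twist_flip tt adj).
  by rewrite -presAlg_scaleAr -presAlg_scaleAl mulr1 mul1r.
have /presAlg_rel E := far j ji jk.
rewrite /rootCoef (negbTE ji) (negbTE jk) scale0r addr0 tpermD 1?eq_sym //.
etransitivity; last (etransitivity; first exact: E).
  by rewrite [RHS]ppiM.
by rewrite -scaleN1r ppiZ scaleN1r ppiM.
Qed.
End CrossRelations.

(** * The second index of each root *)

Section NextIndex.
Variable n : nat.
Implicit Types i : 'I_n.

(** At the last index the default value of [insubd] returns [i] itself, so the transposition becomes
    the identity, as [t_n] in type B requires. *)
Definition nextOrd i : 'I_n := insubd i i.+1.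
(** At the last index the partner is the preceding one, because [t_n] in type D exchanges [b_n] and
    [b_(n-1)]. *)
Definition mateD i : 'I_n := if i.+1 == n then insubd i i.-1 else nextOrd i.

Lemma nextOrdE i : (i.+1 < n)%N -> nextOrd i = i.+1 :> nat.
Proof. by move=> lt; rewrite val_insubd lt. Qed.

Lemma nextOrd_last i : i.+1 = n -> nextOrd i = i.
Proof. by move=> E; apply/val_inj; rewrite val_insubd E ltnn. Qed.

Lemma mateDE i : (i.+1 < n)%N -> mateD i = i.+1 :> nat.
Proof. by move=> lt; rewrite /mateD ltn_eqF // nextOrdE. Qed.

Lemma mateD_last i : i.+1 = n -> mateD i = i.-1 :> nat.
Proof.
move=> E; rewrite /mateD E eqxx val_insubd (_ : (_ < n)%N) //.
by rewrite (leq_ltn_trans (leq_pred i)).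
Qed.
End NextIndex.

(** * Relations common to types B and D *)

Section SpinRelations.
Variables (K : comNzRingType) (n : nat) (u0 : K).
Variables (q : 'I_n -> 'I_n) (u : 'I_n -> K).
Hypothesis qE : forall i : 'I_n, (i.+1 < n)%N -> q i = i.+1 :> nat.
Hypothesis uE : forall i : 'I_n, (i.+1 < n)%N -> u i = u0.
Variable rA : freeAlg K 'I_n -> freeAlg K 'I_n -> Prop.
Hypothesis rA_spin : forall x y, spin_rel (@fgen K 'I_n) x y -> rA x y.
Local Notation S := (presAlg (skew_rel (@fgen K 'I_n))).
Local Notation A := (presAlg rA).
Variables (V : lmodType K) (tau : S -> A -> V).
Hypothesis tauP : tensorProduct tau.
Local Notation T := (twistOp q u tauP).
Local Notation B := (mulB tauP).
Local Notation op := (heckeOp q u tauP).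
Local Notation X := ('I_n + 'I_n)%type.
Local Notation fb j := (fgen K (inl j : X)).
Local Notation ft i := (fgen K (inr i : X)).

Lemma spin_gen_sq i : pgen rA i * pgen rA i = 1.
Proof. by apply: (@pgen_sq _ _ _ rA id); apply/rA_spin/spin_sq. Qed.

Lemma freeAct_exp2 i j : (forall x, T i (T j x) = - T j (T i x)) ->
  freeAct op ((ft i * ft j) ^+ 2) =1 freeAct op (-1).
Proof.
move=> Tij v; rewrite freeAct_genX2 freeActN1 /= Tij.
by rewrite (twistOp_sq q u tauP spin_gen_sq) (twistOp_sq q u tauP spin_gen_sq).
Qed.

(** Rewriting the first four factors turns the word into a palindrome with a minus sign, whose
    involutions cancel from the middle outwards. *)
Lemma freeAct_exp4 i j :
  (forall x, T i (T j (T i (T j x))) = - T j (T i (T j (T i x)))) ->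
  freeAct op ((ft i * ft j) ^+ 4) =1 freeAct op (-1).
Proof.
move=> Tij v; rewrite freeAct_genX4 freeActN1 /= Tij.
by do 4!rewrite (twistOp_sq q u tauP spin_gen_sq).
Qed.

Lemma twistOp_next (i j : 'I_n) : (i.+1 < n)%N -> i.+1 = j :> nat ->
  twisting B (tperm i j) (rootCoef i j u0) (T i).
Proof.
move=> lt ij; have -> : j = q i by apply/val_inj; rewrite /= qE.
by rewrite -(uE lt); exact: twistOp_twisting.
Qed.

Lemma twistOp_far_disjoint (i j : 'I_n) :
  i != j -> i != q j -> q i != j -> q i != q j ->
  (pgen rA i * pgen rA j) ^+ 2 = -1 -> forall x, T i (T j x) = - T j (T i x).
Proof.
move=> ij iqj qij qiqj; apply: (twistOp_far spin_gen_sq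
  (twistOp_twisting q u tauP i) (twistOp_twisting q u tauP j)) => k.
- exact: tperm_far.
- exact: rootCoef_far.
- by apply: rootCoef_far; rewrite eq_sym.
Qed.

Lemma freeAct_spin x y : spin_rel (fun i => ft i) x y ->
  freeAct op x =1 freeAct op y.
Proof.
case=> [i|i j li ij|i j li lj ij] v.
- by rewrite expr2 freeAct_gen2 freeAct1 /= (twistOp_sq q u tauP spin_gen_sq).
- have li' : (i.+1 < n)%N by rewrite /idx in li ij; lia.
  have lj : (j.+1 < n)%N by rewrite /idx in li ij; lia.
  rewrite [LHS]freeAct_gen3 [RHS]freeAct_gen3 /=.
  (* The roots are [{i, j}] and [{j, q j}]; the bound on [i] ensures that [j] is not last, so [q j]
     is its successor. *)
  apply: (@twistOp_braid _ _ q u _ _ _ tauP spin_gen_sq i j i j (q j) u0).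
  + by apply/eqP => /(congr1 val) /=; rewrite /idx in ij; lia.
  + by apply/eqP => /(congr1 val) /=; rewrite qE //; lia.
  + by apply/eqP => /(congr1 val) /=; rewrite qE //; rewrite /idx in ij; lia.
  + by apply: twistOp_next => //; rewrite /idx in ij; lia.
  + by apply: twistOp_next => //; rewrite qE.
  + by apply: (@pgen_braid _ _ _ rA id); apply/rA_spin/spin_braid.
- rewrite /idx in li lj ij.
  have li' : (i.+1 < n)%N by have := ltn_ord i; lia.
  have lj' : (j.+1 < n)%N by have := ltn_ord j; lia.
  apply: freeAct_exp2; apply: twistOp_far_disjoint.
  + by apply/eqP => /(congr1 val) /=; lia.
  + by apply/eqP => /(congr1 val) /=; rewrite qE //; lia.
  + by apply/eqP => /(congr1 val) /=; rewrite qE //; lia.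
  + by apply/eqP => /(congr1 val) /=; rewrite !qE //; lia.
  + by apply: (@pgen_exp_opp _ _ _ rA id); apply/rA_spin/spin_far.
Qed.

Lemma freeAct_skew x y : skew_rel (fun j => fb j) x y ->
  freeAct op x =1 freeAct op y.
Proof.
apply: freeAct_skew_rel (mulB_anticomm tauP) _ _ => i v.
exact: (freeAct_gen op).
Qed.

Lemma freeAct_cross x y : cross_rel (fun j => fb j) (fun i => ft i) u0 x y ->
  freeAct op x =1 freeAct op y.
Proof.
case=> [i j|i j]; rewrite /idx => li ij.
  have li' : (i.+1 < n)%N by have := ltn_ord i; lia.
  rewrite -(uE li'); apply: freeAct_cross_adj; last by rewrite eqxx.
  by rewrite tpermL; apply/val_inj; rewrite /= qE //; lia.
move=> ijS; have li' : (i.+1 < n)%N by have := ltn_ord i; lia.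
apply: freeAct_cross_far; apply/eqP => /(congr1 val) /=; rewrite ?qE //; lia.
Qed.

End SpinRelations.

Lemma tens_tensorProduct (K : comNzRingType) (A B : lmodType K) :
  tensorProduct (@tens K A B).
Proof.
split=> [b c x y|a c x y|P PD Pt|W g gl gr].
- by rewrite tensDl tensZl.
- by rewrite tensDr tensZr.
- exact: tensor_ind.
- exact: tensor_lift.
Qed.

(** * Types B and D *)

Section TypeB.
Variables (K : comNzRingType) (n : nat) (u v : K).

Definition coefB (i : 'I_n) : K := if i.+1 == n then v else u.

Local Notation X := ('I_n + 'I_n)%type.
Local Notation rA := (spinB_rel (@fgen K 'I_n)).
Local Notation rH := (heckeB_rel n u v).
Local Notation q := (@nextOrd n).
Local Notation fb j := (fgen K (inl j : X)).
Local Notation ft i := (fgen K (inr i : X)).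
Local Notation tauP := (@tens_tensorProduct K
  (presAlg (skew_rel (@fgen K 'I_n))) (presAlg rA)).

Lemma coefB_next (i : 'I_n) : (i.+1 < n)%N -> coefB i = u.
Proof. by move=> lt; rewrite /coefB ltn_eqF. Qed.

Lemma coefB_last (i : 'I_n) : i.+1 = n -> coefB i = v.
Proof. by move=> E; rewrite /coefB E eqxx. Qed.

Lemma heckeB_cross i j :
  pgen rH (inr i) * pgen rH (inl j) =
  - (pgen rH (inl (tperm i (q i) j)) * pgen rH (inr i)) +
  rootCoef i (q i) (coefB i) j *: (1 : presAlg rH).
Proof.
apply: cross_of_rel => [||k ki kq].
- apply: (@pgen_sq _ _ _ rH (@inr _ _)); apply: Or32; apply: spinB_common.
  exact: spin_sq.
- have [iE|lt] : i.+1 = n \/ (i.+1 < n)%N by have := ltn_ord i; lia.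
    (* At the last index the root is the single index [i], and the relation is the one with
       parameter [v]. *)
    rewrite (coefB_last iE) (nextOrd_last iE); apply: Or33; exact: crossB_last.
  rewrite (coefB_next lt); apply: Or33; apply: crossB_common.
  by apply: cross_adj; rewrite /idx ?nextOrdE //; lia.
- apply: Or33.
  have kiN : k <> i :> nat by move=> E; case/eqP: ki; exact: val_inj.
  have [iE|lt] : i.+1 = n \/ (i.+1 < n)%N by have := ltn_ord i; lia.
    by apply: crossB_far; rewrite /idx; lia.
  have kqN : k <> i.+1 :> nat.
    by move=> E; case/eqP: kq; apply/val_inj; rewrite /= nextOrdE.
  by apply: crossB_common; apply: cross_far; rewrite /idx; lia.
Qed.

Lemma freeAct_heckeB x y : rH x y ->
  freeAct (heckeOp q coefB tauP) x =1 freeAct (heckeOp q coefB tauP) y.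
Proof.
have spin a b : spin_rel (@fgen K 'I_n) a b -> rA a b by exact: spinB_common.
case; first exact: freeAct_skew.
  case=> [a b|i l lE li|p l lE pE].
  - exact: (freeAct_spin (@nextOrdE n) coefB_next spin).
  - rewrite /idx in lE li; apply: (freeAct_exp2 spin).
    have lt : (i.+1 < n)%N by lia.
    (* The root of [l] is [{l}], and the bound on [i] keeps [i.+1] strictly below [l]. *)
    apply: (twistOp_far_disjoint coefB spin tauP); rewrite ?(nextOrd_last lE).
    + by apply/eqP => /(congr1 val) /=; lia.
    + by apply/eqP => /(congr1 val) /=; lia.
    + by apply/eqP => /(congr1 val) /=; rewrite nextOrdE //; lia.
    + by apply/eqP => /(congr1 val) /=; rewrite nextOrdE //; lia.
    + by apply: (@pgen_exp_opp _ _ _ rA id); exact: spinB_far.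
  - apply: (freeAct_exp4 spin).
    apply: (twistOp_B4 coefB tauP (spin_gen_sq spin)).
      exact: nextOrd_last.
    by apply: (@pgen_exp_opp _ _ _ rA id); exact: spinB_last.
case=> [a b|l lE|i l lE iN].
- exact: (freeAct_cross (@nextOrdE n) coefB_next).
- rewrite -(coefB_last lE); apply: freeAct_cross_adj; last by rewrite eqxx.
  by rewrite tpermL nextOrd_last.
- rewrite /idx in lE iN; apply: freeAct_cross_far; rewrite ?(nextOrd_last lE).
    by apply/eqP => /(congr1 val) /=; lia.
  by apply/eqP => /(congr1 val) /=; lia.
Qed.

Theorem spinHeckeB_pbw :
  exists2 m : {linear tensor (skewPoly K n) (spinWeylB K n) ->
                      spinHeckeB n u v},
    forall f w, m (tens f w) = skew_inB n u v f * weyl_inB n u v w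
    & bijective m.
Proof.
exact: (mul_bijective (@skew_inB_rel K n u v) (@weyl_inB_rel K n u v)
  heckeB_cross freeAct_heckeB).
Qed.
End TypeB.

(** * Type D: the last root lies on the last two indices *)

Section TypeD.
Variables (K : comNzRingType) (n : nat) (u : K).
Hypothesis n_ge4 : (4 <= n)%N.

Local Notation X := ('I_n + 'I_n)%type.
Local Notation rA := (spinD_rel (@fgen K 'I_n)).
Local Notation rH := (heckeD_rel n u).
Local Notation q := (@mateD n).
Local Notation coef := (fun=> u).
Local Notation fb j := (fgen K (inl j : X)).
Local Notation ft i := (fgen K (inr i : X)).
Local Notation tauP := (@tens_tensorProduct K
  (presAlg (skew_rel (@fgen K 'I_n))) (presAlg rA)).

Lemma heckeD_cross i j :
  pgen rH (inr i) * pgen rH (inl j) =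
  - (pgen rH (inl (tperm i (q i) j)) * pgen rH (inr i)) +
  rootCoef i (q i) u j *: (1 : presAlg rH).
Proof.
apply: cross_of_rel => [||k ki kq].
- apply: (@pgen_sq _ _ _ rH (@inr _ _)); apply: Or32; apply: spinD_common.
  exact: spin_sq.
- apply: Or33.
  have [iE|lt] : i.+1 = n \/ (i.+1 < n)%N by have := ltn_ord i; lia.
    (* Here [idx (q i)] is [i.-1.+1]; it equals [n - 1] because [n_ge4] makes [i] positive. *)
    by apply: crossD_last; rewrite /idx ?mateD_last //; lia.
  apply: crossD_common.
  by apply: cross_adj; rewrite /idx ?mateDE //; lia.
- apply: Or33.
  have kiN : k <> i :> nat by move=> E; case/eqP: ki; exact: val_inj.
  have [iE|lt] : i.+1 = n \/ (i.+1 < n)%N by have := ltn_ord i; lia.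
    have kqN : k <> i.-1 :> nat.
      by move=> E; case/eqP: kq; apply/val_inj; rewrite /= mateD_last.
    by apply: crossD_far; rewrite /idx; lia.
  have kqN : k <> i.+1 :> nat.
    by move=> E; case/eqP: kq; apply/val_inj; rewrite /= mateDE.
  by apply: crossD_common; apply: cross_far; rewrite /idx; lia.
Qed.

Lemma freeAct_heckeD x y : rH x y ->
  freeAct (heckeOp q coef tauP) x =1 freeAct (heckeOp q coef tauP) y.
Proof.
have spin a b : spin_rel (@fgen K 'I_n) a b -> rA a b by exact: spinD_common.
have coefE (i : 'I_n) : (i.+1 < n)%N -> coef i = u by [].
case; first exact: freeAct_skew.
  case=> [a b|i l lE i2 iN|p l lE pE].
  - exact: (freeAct_spin (@mateDE n) coefE spin).
  - rewrite /idx in lE i2 iN; apply: (freeAct_exp2 spin).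
    have lt : (i.+1 < n)%N by have := ltn_ord i; lia.
    have til : (pgen rA i * pgen rA l) ^+ 2 = -1.
      by apply: (@pgen_exp_opp _ _ _ rA id); exact: spinD_far.
    have [iE|iNl] := eqVneq i.+1 (l : nat).
      (* In one-based terms this is the pair [t_(n-1)], [t_n]: both operators have the same
         transposition and the same coefficients, so the conditions reduce to [rootCoefK]. *)
      have qi : q i = l by apply/val_inj; rewrite /= mateDE.
      have ql : q l = i by apply/val_inj; rewrite /= mateD_last //; lia.
      have Tl := twistOpC q coef tauP l; rewrite ql in Tl.
      have Ti := twistOp_twisting q coef tauP i; rewrite qi in Ti.
      apply: (twistOp_far (spin_gen_sq spin) Ti Tl) => // k; exact: rootCoefK.
    (* Now [i] is at most [n - 3] in one-based terms, so its root avoids the last two indices. *)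
    apply: (twistOp_far_disjoint coef spin tauP) => //.
    + by apply/eqP => /(congr1 val) /=; lia.
    + by apply/eqP => /(congr1 val) /=; rewrite mateD_last //; lia.
    + by apply/eqP => /(congr1 val) /=; rewrite mateDE //; lia.
    + by apply/eqP => /(congr1 val) /=; rewrite mateDE // mateD_last //; lia.
  - rewrite /idx in lE pE => w.
    have lt : (p.+1 < n)%N by lia.
    (* The roots of [t_(n-2)] and [t_n] share exactly the one-based index [n - 1], which is the
       middle index of the braid lemma. *)
    have ql : q l = q p.
      by apply/val_inj; rewrite /= (mateDE lt) (mateD_last lE); lia.
    have Tl := twistOpC q coef tauP l; rewrite ql in Tl.
    have Tp := twistOp_twisting q coef tauP p.
    rewrite [LHS]freeAct_gen3 [RHS]freeAct_gen3 /=.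
    apply: (twistOp_braid (spin_gen_sq spin) _ _ _ Tp Tl).
    + by apply/eqP => /(congr1 val) /=; rewrite mateDE //; lia.
    + by apply/eqP => /(congr1 val) /=; rewrite mateDE //; lia.
    + by apply/eqP => /(congr1 val) /=; lia.
    + by apply: (@pgen_braid _ _ _ rA id); exact: spinD_braid.
case=> [a b|p l lE pE|i l lE i1 iN].
- exact: (freeAct_cross (@mateDE n) coefE).
- apply: (@freeAct_cross_adj _ _ q coef); last by rewrite eqxx.
  rewrite tpermL; apply/val_inj; rewrite /= mateD_last //.
  by rewrite /idx in lE pE; lia.
- rewrite /idx in lE i1 iN; apply: freeAct_cross_far.
    by apply/eqP => /(congr1 val) /=; lia.
  by apply/eqP => /(congr1 val) /=; rewrite mateD_last //; lia.
Qed.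

Theorem spinHeckeD_pbw :
  exists2 m : {linear tensor (skewPoly K n) (spinWeylD K n) ->
                      spinHeckeD n u},
    forall f w, m (tens f w) = skew_inD n u f * weyl_inD n u w
    & bijective m.
Proof.
exact: (mul_bijective (@skew_inD_rel K n u) (@weyl_inD_rel K n u)
  heckeD_cross freeAct_heckeD).
Qed.
End TypeD.

Theorem theorem4p5 (R : realType) :
  (forall (n : nat) (u : R[i]%C), (4 <= n)%N ->
     exists2 m : {linear tensor (skewPoly R[i]%C n) (spinWeylD R[i]%C n)
                         -> spinHeckeD n u},
       forall f w, m (tens f w) = skew_inD n u f * weyl_inD n u w
       & bijective m)
  /\
  (forall (n : nat) (u v : R[i]%C), (2 <= n)%N ->
     exists2 m : {linear tensor (skewPoly R[i]%C n) (spinWeylB R[i]%C n)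
                         -> spinHeckeB n u v},
       forall f w, m (tens f w) = skew_inB n u v f * weyl_inB n u v w
       & bijective m).
Proof.
by split=> [n u n_ge4|n u v _]; [exact: spinHeckeD_pbw | exact: spinHeckeB_pbw].
Qed.
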